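(* Let $A=\mathrm{Mat}(N,\mathbb{C})$. All nondegenerate unitary solutions $r(u)\in A\otimes A$ of the equation $$r^{12}(-u')r^{13}(u+u')-r^{23}(u+u')r^{12}(u)+r^{13}(u)r^{23}(u')=0$$ have the form $$r(u)=(\phi_a(cu)\otimes\mathrm{id})(P),$$ where $c\in\mathbb{C}^*$, $a\in\mathfrak{sl}_N$, and $\phi_a(u)\in\mathrm{End}(A)$ is the linear operator on $A$ defined from the equation $$u\,\phi_a(u)(X)+[a,\phi_a(u)(X)]=X\qquad (X\in A).$$
   Context: $r(u)$ is a meromorphic $A\otimes A$-valued function in a neighborhood of $0\in\mathbb{C}$; it is nondegenerate if the tensor $r(u)$ is nondegenerate for generic $u$, and unitary if $r^{21}(-u)=-r(u)$, where $r^{21}$ is $r$ with tensor factors exchanged. Here $r^{12}=r\otimes 1\in A\otimes A\otimes A$, and $r^{13},r^{23}$ are defined similarly. $P=\sum_{i,j}e_{ij}\otimes e_{ji}$, where $e_{ij}$ are the matrix units. *)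

(* Defs.v *)
From HB Require Import structures.
From mathcomp Require Import all_boot all_order all_algebra.
From mathcomp Require Import all_classical all_reals all_analysis.
From mathcomp Require Import complex mxtens.

Set Implicit Arguments.
Unset Strict Implicit.
Unset Printing Implicit Defensive.

Import Order.TTheory GRing.Theory Num.Theory.
Import numFieldNormedType.Exports.
Local Open Scope ring_scope.
Local Open Scope classical_set_scope.
Local Open Scope complex_scope.

(* For A = 'M[K]_N, the algebras A (x) A and A (x) A (x) A are realized as
   'M[K]_(N * N) and 'M[K]_(N * N * N) through the Kronecker product [*t]:
   the pure tensor X (x) Y is [X *t Y], and X (x) Y (x) Z is [X *t Y *t Z]. *)
Section Tensor.
Variables (K : fieldType) (N : nat).
Local Notation A := 'M[K]_N.

(* coefficient of [delta_mx i j *t delta_mx k l] in t *)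
Definition tens_coef (t : 'M[K]_(N * N)) (i j k l : 'I_N) : K :=
  t (mxtens_index (i, k)) (mxtens_index (j, l)).

(* the linear map on A (x) A induced by a bilinear map f on A * A *)
Definition tens_lift (V : lmodType K) (f : A -> A -> V) (t : 'M[K]_(N * N)) : V :=
  \sum_i \sum_j \sum_k \sum_l
    tens_coef t i j k l *: f (delta_mx i j) (delta_mx k l).

Definition tens12 : 'M[K]_(N * N) -> 'M[K]_(N * N * N) :=
  tens_lift (fun X Y => X *t Y *t (1%:M : A)).

Definition tens13 : 'M[K]_(N * N) -> 'M[K]_(N * N * N) :=
  tens_lift (fun X Y => X *t (1%:M : A) *t Y).

Definition tens23 : 'M[K]_(N * N) -> 'M[K]_(N * N * N) :=
  tens_lift (fun X Y => (1%:M : A) *t X *t Y).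

Definition tens21 : 'M[K]_(N * N) -> 'M[K]_(N * N) :=
  tens_lift (fun X Y => Y *t X).

(* (phi (x) id)(t) *)
Definition tens_map1 (phi : 'End(A)) : 'M[K]_(N * N) -> 'M[K]_(N * N) :=
  tens_lift (fun X Y => phi X *t Y).

(* t is nondegenerate when A^* -> A, xi |-> (xi (x) id)(t), is bijective *)
Definition tens_nondegenerate (t : 'M[K]_(N * N)) : Prop :=
  bijective (fun xi : 'Hom(A, K^o) => tens_lift (fun X Y => xi X *: Y) t).

Definition tensP : 'M[K]_(N * N) :=
  \sum_i \sum_j (delta_mx i j : A) *t (delta_mx j i : A).

(* phi = phi_a(u); the equation says that phi is right inverse to the operator
   u + [a, -] on the finite-dimensional space A, so it determines phi. *)
Definition is_phi (a : A) (u : K) (phi : 'End(A)) : Prop :=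
  forall X : A, u *: phi X + (a *m phi X - phi X *m a) = X.

Lemma tens_coef_pure (X Y : A) i j k l :
  tens_coef (X *t Y) i j k l = X i j * Y k l.
Proof. by rewrite /tens_coef tensmxE. Qed.

Lemma tens_lift_pure (V : lmodType K) (f : A -> A -> V) (X Y : A) :
  (forall Y', linear (f^~ Y')) -> (forall X', linear (f X')) ->
  tens_lift f (X *t Y) = f X Y.
Proof.
move=> fl fr.
have suml (Z : A) : f X Z = \sum_i \sum_j X i j *: f (delta_mx i j) Z.
  pose g := GRing.isLinear.Build _ _ _ _ (f^~ Z) (fl Z).
  pose F : {linear A -> V} := HB.pack (f^~ Z) g.
  rewrite -[LHS]/(F X) {1}(matrix_sum_delta X) linear_sum.
  by apply: eq_bigr => i _; rewrite linear_sum; apply: eq_bigr => j _; rewrite linearZ.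
have sumr (W : A) : f W Y = \sum_k \sum_l Y k l *: f W (delta_mx k l).
  pose g := GRing.isLinear.Build _ _ _ _ (f W) (fr W).
  pose F : {linear A -> V} := HB.pack (f W) g.
  rewrite -[LHS]/(F Y) {1}(matrix_sum_delta Y) linear_sum.
  by apply: eq_bigr => i _; rewrite linear_sum; apply: eq_bigr => j _; rewrite linearZ.
rewrite suml /tens_lift; apply: eq_bigr => i _; apply: eq_bigr => j _.
rewrite sumr scaler_sumr; apply: eq_bigr => k _; rewrite scaler_sumr.
by apply: eq_bigr => l _; rewrite tens_coef_pure scalerA.
Qed.

Lemma is_phi_uniq (a : A) (u : K) (phi psi : 'End(A)) :
  is_phi a u phi -> is_phi a u psi -> phi = psi.
Proof.
move=> Hphi Hpsi.
pose T X := u *: X + (a *m X - X *m a).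
have Tl : linear T.
  move=> k X Y; rewrite /T mulmxDr mulmxDl -scalemxAr -scalemxAl scalerDr opprD.
  rewrite [X in _ + X = _]addrACA [LHS]addrACA -scalerBr scalerA mulrC -scalerA.
  by rewrite -scalerDr.
pose g := GRing.isLinear.Build _ _ _ _ T Tl.
pose F : {linear A -> A} := HB.pack T g.
have K1 (phi' : 'End(A)) : is_phi a u phi' -> (linfun F \o phi' = \1)%VF.
  by move=> H; apply/lfunP => X; rewrite comp_lfunE lfunE id_lfunE; apply: H.
have inj : lker phi == 0%VS.
  by apply/lker0P => X Y e; rewrite -(Hphi X) -(Hphi Y) e.
have K2 : (phi \o linfun F = \1)%VF.
  rewrite -[LHS]comp_lfun1r -(lker0_compfV inj) -comp_lfunA.
  by rewrite (comp_lfunA (linfun F)) (K1 _ Hphi) comp_lfun1l.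
by rewrite -[LHS]comp_lfun1r -(K1 _ Hpsi) comp_lfunA K2 comp_lfun1l.
Qed.

End Tensor.

Section Meromorphic.
Variable R : realType.
(* R[i] carries its norm and topology through the alias R[i]^o *)
Local Notation C := R[i].
Local Notation Ctop := R[i]^o.

Definition holomorphic_at (f : Ctop -> Ctop) (z0 : Ctop) : Prop :=
  \forall z \near z0, derivable f z 1.

(* The value of f at a pole, and more generally at z0, is irrelevant. *)
Definition meromorphic_at (f : Ctop -> Ctop) (z0 : Ctop) : Prop :=
  exists (n : nat) (g : Ctop -> Ctop), holomorphic_at g z0 /\
    \forall z \near z0^', (z - z0) ^+ n * f z = g z.

Definition mx_meromorphic_near0 (m n : nat) (r : Ctop -> 'M[C]_(m, n)) : Prop :=
  forall i j, \forall z \near (0 : Ctop), meromorphic_at (fun u => r u i j) z.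

(* r is regarded as a germ at 0 of a meromorphic function; as such it is
   holomorphic in a punctured neighborhood of 0, and conditions on it are
   imposed close to 0 and away from the poles. *)
Variable N : nat.
Implicit Type r : Ctop -> 'M[C]_(N * N).

Definition generically_nondegenerate r : Prop :=
  \forall u \near (0 : Ctop)^', tens_nondegenerate (r u).

Definition unitary r : Prop :=
  \forall u \near (0 : Ctop)^', tens21 (r (- u)) = - r u.

Definition AYBE r : Prop :=
  \forall u & u' \near (0 : Ctop), u != 0 -> u' != 0 -> u + u' != 0 ->
    tens12 (r (- u')) *m tens13 (r (u + u'))
    - tens23 (r (u + u')) *m tens12 (r u)
    + tens13 (r u) *m tens23 (r u') = 0.

End Meromorphic.

(* Main.v *)
Require Import Defs.
From HB Require Import structures.
From mathcomp Require Import all_boot all_order all_algebra.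
From mathcomp Require Import all_classical all_reals all_analysis.
From mathcomp Require Import complex mxtens.
Import Order.TTheory GRing.Theory Num.Theory.
Import numFieldNormedType.Exports.
Local Open Scope ring_scope.
Local Open Scope classical_set_scope.
Local Open Scope complex_scope.

(** Through the trace form, a tensor [t] in A (x) A is the same thing as the
operator Y |-> (id (x) tr)(t (1 (x) Y)) on A, here [tensor_op t], and t is
recovered as its value on the first factor of P ([tens_map1_tensP]).  Write
phi_u for the operator of r(u).  Contracting the equation with Y and Z in the
second and third factors, and using unitarity to turn the adjoint of phi_(u')
for the trace form into -phi_(-u'), gives with p = -u' and q = u + u' the
identity ([AYBE_op])

   phi_p(Y) phi_q(Z) = phi_(p+q)(Y phi_q(Z) + phi_p(Y) Z).

Nondegeneracy and unitarity make phi_u invertible ([tensor_op_nondegenerate]),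
and for psi_u = phi_u^-1 the identity becomes a twisted Leibniz rule
([psi_mul])

   psi_(p+q)(YZ) = psi_p(Y) Z + Y psi_q(Z).

Setting Y = 1 or Z = 1 yields two expressions of psi_(p+q)(X), by psi_p(1) X
and by X psi_q(1).  Comparing them shows that psi_p(1) is central, hence a
scalar beta(p), additive in p, and that D = psi_p - beta(p) does not depend on
p.  Then D obeys the Leibniz rule, so it is an inner derivation [a, -], where a
may be taken traceless ([derivation_inner], [rota_baxter_classification]).

Finally 1/beta(u) is the common value of the diagonal entries of phi_u(1), so
beta is holomorphic in a punctured neighborhood of 0.  An additive function
that is complex differentiable at one point is C-linear near 0
([local_additive_linear]), so beta(u) = cu, where c is nonzero since
beta(u) has an inverse.  Therefore phi_u inverts the operator
X |-> cu X + [a, X]. *)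

(** * Tensors as operators *)

Section TensorOperator.
Set Implicit Arguments.
Unset Strict Implicit.
Unset Printing Implicit Defensive.
Variables (K : fieldType) (N : nat).
Local Notation A := 'M[K]_N.
Implicit Types (s t : 'M[K]_(N * N)) (X Y Z : A) (i j k l m n : 'I_N).
Local Notation E i j := (delta_mx i j : A).

Lemma tensor_eqP s t :
  (forall i j k l, tens_coef s i j k l = tens_coef t i j k l) -> s = t.
Proof.
move=> st; apply/matrixP => x y.
case: (mxtens_indexP x) => i k; case: (mxtens_indexP y) => j l.
exact: st.
Qed.

(** Every entry of an image of [tens_lift] below is a fourfold sum against a
product of two matrix units, and this evaluates it. *)
Lemma sum4_only (F : 'I_N -> 'I_N -> 'I_N -> 'I_N -> K) i0 j0 k0 l0 :
  \sum_i \sum_j \sum_k \sum_l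
    F i j k l * (((i0 == i) && (j0 == j))%:R * ((k0 == k) && (l0 == l))%:R)
  = F i0 j0 k0 l0.
Proof.
rewrite (big_only1 i0)//; last first.
  move=> i /negPf ni _; do 3 rewrite big1// => ? _.
  by rewrite eq_sym ni mul0r mulr0.
rewrite (big_only1 j0)//; last first.
  move=> i /negPf ni _; do 2 rewrite big1// => ? _.
  by rewrite [j0 == _]eq_sym ni andbF mul0r mulr0.
rewrite (big_only1 k0)//; last first.
  move=> i /negPf ni _; rewrite big1// => ? _.
  by rewrite [k0 == _]eq_sym ni !mulr0.
rewrite (big_only1 l0)//; last first.
  move=> i /negPf ni _.
  by rewrite [l0 == _]eq_sym ni andbF !mulr0.
by rewrite !eqxx !mulr1.
Qed.

Lemma tens_liftE p q (f : A -> A -> 'M[K]_(p, q)) t x y :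
  tens_lift f t x y =
  \sum_i \sum_j \sum_k \sum_l tens_coef t i j k l * f (E i j) (E k l) x y.
Proof.
rewrite /tens_lift; do 4 (rewrite summxE; apply: eq_bigr => ? _).
by rewrite mxE.
Qed.

Lemma tens12E t i j k l m n :
  tens12 t (mxtens_index (mxtens_index (i, k), m))
           (mxtens_index (mxtens_index (j, l), n))
  = tens_coef t i j k l * (m == n)%:R.
Proof.
rewrite tens_liftE.
rewrite -(sum4_only (fun i j k l => tens_coef t i j k l * (m == n)%:R)).
do 4 apply: eq_bigr => ? _.
by rewrite !tensmxE !mxE -[RHS]mulrA; congr (_ * _); rewrite [RHS]mulrC.
Qed.

Lemma tens13E t i j k l m n :
  tens13 t (mxtens_index (mxtens_index (i, k), m))
           (mxtens_index (mxtens_index (j, l), n))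
  = tens_coef t i j m n * (k == l)%:R.
Proof.
rewrite tens_liftE.
rewrite -(sum4_only (fun i j m n => tens_coef t i j m n * (k == l)%:R)).
do 4 apply: eq_bigr => ? _.
by rewrite !tensmxE !mxE -!mulrA; congr (_ * _); rewrite mulrCA.
Qed.

Lemma tens23E t i j k l m n :
  tens23 t (mxtens_index (mxtens_index (i, k), m))
           (mxtens_index (mxtens_index (j, l), n))
  = tens_coef t k l m n * (i == j)%:R.
Proof.
rewrite tens_liftE.
rewrite -(sum4_only (fun k l m n => tens_coef t k l m n * (i == j)%:R)).
do 4 apply: eq_bigr => ? _.
by rewrite !tensmxE !mxE -!mulrA.
Qed.

Lemma tens_coef_tens21 t i j k l :
  tens_coef (tens21 t) i j k l = tens_coef t k l i j.
Proof.
rewrite {1}/tens_coef tens_liftE -(sum4_only (tens_coef t)).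
do 4 apply: eq_bigr => ? _.
by rewrite !tensmxE !mxE; congr (_ * _); rewrite mulrC.
Qed.

Lemma tens_coefN t i j k l : tens_coef (- t) i j k l = - tens_coef t i j k l.
Proof. by rewrite /tens_coef mxE. Qed.

(** [(id (x) tr)(t (1 (x) Y))]: the factor [delta_mx k l] contributes
[\tr (delta_mx k l *m Y) = Y l k]. *)
Definition tensor_op_fun t Y : A :=
  \matrix_(i, j) \sum_k \sum_l tens_coef t i j k l * Y l k.

Lemma tensor_op_linear t : linear (tensor_op_fun t).
Proof.
move=> a Y Z; apply/matrixP => i j; rewrite !mxE mulr_sumr -big_split /=.
apply: eq_bigr => k _; rewrite mulr_sumr -big_split; apply: eq_bigr => l _ /=.
by rewrite !mxE mulrDr mulrCA.
Qed.

HB.instance Definition _ t := GRing.isLinear.Build _ _ _ _ _ (tensor_op_linear t).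

Definition tensor_op t : 'End(A) := linfun (tensor_op_fun t).

Lemma tensor_opE t Y i j :
  tensor_op t Y i j = \sum_k \sum_l tens_coef t i j k l * Y l k.
Proof. by rewrite lfunE /= mxE. Qed.

Lemma tensor_op_delta t i j k l : tensor_op t (E l k) i j = tens_coef t i j k l.
Proof.
rewrite tensor_opE (big_only1 k)//; last first.
  move=> k' /negPf nk _; rewrite big1// => l' _.
  by rewrite mxE nk andbF mulr0.
rewrite (big_only1 l)//; last by move=> l' /negPf nl _; rewrite mxE nl mulr0.
by rewrite mxE !eqxx mulr1.
Qed.

(** [tensP] is the copairing dual to the trace form, so contracting and then
applying the operator to it gives back the tensor. *)
Lemma tens_map1_tensP t : tens_map1 (tensor_op t) (tensP K N) = t.
Proof.
apply: tensor_eqP => i j k l; rewrite {1}/tens_coef tens_liftE.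
under eq_bigr => a _ do under eq_bigr => b _ do
  under eq_bigr => c _ do under eq_bigr => d _ do rewrite tensmxE.
rewrite -[RHS](sum4_only (fun l k _ _ => tens_coef t i j k l) l k k l).
apply: eq_bigr => a _; apply: eq_bigr => b _.
rewrite (big_only1 k)//; last first.
  move=> c /negPf nc _; rewrite big1// => d _.
  by rewrite [E c d _ _]mxE [k == c]eq_sym nc !mulr0.
rewrite [RHS](big_only1 k)//; last first.
  move=> c /negPf nc _; rewrite big1// => d _.
  by rewrite [k == c]eq_sym nc !mulr0.
rewrite (big_only1 l)//; last first.
  by move=> d /negPf nd _; rewrite [E k d _ _]mxE [l == d]eq_sym nd andbF !mulr0.
rewrite [RHS](big_only1 l)//; last first.
  by move=> d /negPf nd _; rewrite [l == d]eq_sym nd andbF !mulr0.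
rewrite tensor_op_delta mxE !eqxx !mulr1 mulrC; congr (_ * _).
rewrite /tens_coef /tensP summxE (big_only1 a)//; last first.
  move=> c /negPf nc _; rewrite summxE big1// => d _.
  by rewrite tensmxE !mxE [a == _]eq_sym nc mul0r.
rewrite summxE (big_only1 b)//; last first.
  move=> c /negPf nc _.
  by rewrite tensmxE !mxE [b == _]eq_sym nc andbF mul0r.
by rewrite tensmxE !mxE !eqxx mul1r andbC.
Qed.

Lemma lin_delta_ext (V : lmodType K) (f g : A -> V) :
  linear f -> linear g -> (forall i j, f (E i j) = g (E i j)) -> f =1 g.
Proof.
move=> fl gl fg X.
pose F : {linear A -> V} := HB.pack f (GRing.isLinear.Build _ _ _ _ f fl).
pose G : {linear A -> V} := HB.pack g (GRing.isLinear.Build _ _ _ _ g gl).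
rewrite -[f X]/(F X) -[g X]/(G X) (matrix_sum_delta X) !linear_sum.
apply: eq_bigr => i _; rewrite !linear_sum; apply: eq_bigr => j _.
by rewrite !linearZ /= fg.
Qed.

Lemma delta_mulmxE X i j k l : (E i j *m X) k l = (k == i)%:R * X j l.
Proof.
rewrite mxE (big_only1 j)//; last first.
  by move=> a /negPf na _; rewrite mxE na andbF mul0r.
by rewrite mxE eqxx andbT.
Qed.

Lemma mulmx_deltaE X i j k l : (X *m E i j) k l = X k i * (l == j)%:R.
Proof.
rewrite mxE (big_only1 i)//; last first.
  by move=> a /negPf na _; rewrite mxE na mulr0.
by rewrite mxE eqxx.
Qed.

Lemma mulmx3E (S T : 'M[K]_(N * N * N)) x y : (S *m T) x y =
  \sum_i \sum_k \sum_m
    S x (mxtens_index (mxtens_index (i, k), m)) *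
    T (mxtens_index (mxtens_index (i, k), m)) y.
Proof.
have reindex (m n : nat) (F : 'I_(m * n) -> K) :
    \sum_x F x = \sum_i \sum_j F (mxtens_index (i, j)).
  rewrite pair_big (reindex (@mxtens_index m n)) /=.
    by apply: eq_bigr => -[].
  by exists (@mxtens_unindex m n) => ? _; rewrite ?mxtens_indexK ?mxtens_unindexK.
by rewrite mxE reindex reindex.
Qed.

(** The equation read through the trace form, with [rp], [rq], [ru], [ru']
standing for the values at [-u'], [u + u'], [u], [u'].  Both sides are bilinear
in Y and Z, so it is enough to compare them on matrix units, where each of the
three products of the equation collapses to a single sum.  Unitarity enters in
the third term only: there the operator of [ru'] acts through its adjoint,
which is the opposite of the operator of [rp]. *)
Lemma AYBE_op (rp rq ru ru' : 'M[K]_(N * N)) :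
  tens21 rp = - ru' ->
  tens12 rp *m tens13 rq - tens23 rq *m tens12 ru + tens13 ru *m tens23 ru' = 0 ->
  forall Y Z, tensor_op rp Y *m tensor_op rq Z
    = tensor_op ru (Y *m tensor_op rq Z + tensor_op rp Y *m Z).
Proof.
move=> unit aybe Y Z.
pose f Y Z := tensor_op rp Y *m tensor_op rq Z.
pose g Y Z := tensor_op ru (Y *m tensor_op rq Z + tensor_op rp Y *m Z).
have fl Z' : linear (f^~ Z').
  by move=> c U V; rewrite /f linearP mulmxDl scalemxAl.
have fr Y' : linear (f Y').
  by move=> c U V; rewrite /f linearP mulmxDr scalemxAr.
have gl Z' : linear (g^~ Z').
  move=> c U V; rewrite /g linearP !mulmxDl -!scalemxAl addrACA -scalerDr.
  by rewrite linearP.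
have gr Y' : linear (g Y').
  move=> c U V; rewrite /g linearP !mulmxDr -!scalemxAr addrACA -scalerDr.
  by rewrite linearP.
rewrite -[LHS]/(f Y Z) -[RHS]/(g Y Z).
apply: (lin_delta_ext (fr Y) (gr Y)) => n m.
apply: (lin_delta_ext (fl (E n m)) (gl (E n m))) => l k.
apply/matrixP => i j.
pose x := mxtens_index (mxtens_index (i, k), m).
pose y := mxtens_index (mxtens_index (j, l), n).
have addE (U V : 'M[K]_(N * N * N)) : (U + V) x y = U x y + V x y.
  by rewrite mxE.
have oppE (U : 'M[K]_(N * N * N)) : (- U) x y = - U x y by rewrite mxE.
have := congr1 (fun M : 'M[K]_(N * N * N) => M x y) aybe.
rewrite !addE oppE !mulmx3E [RHS]mxE /x /y.
have -> : \sum_a \sum_b \sum_c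
    tens12 rp (mxtens_index (mxtens_index (i, k), m))
              (mxtens_index (mxtens_index (a, b), c)) *
    tens13 rq (mxtens_index (mxtens_index (a, b), c))
              (mxtens_index (mxtens_index (j, l), n))
  = f (E l k) (E n m) i j.
  rewrite mxE; apply: eq_bigr => a _; rewrite !tensor_op_delta.
  rewrite (big_only1 l)//; last first.
    move=> b /negPf nb _; rewrite big1// => c _.
    by rewrite tens13E nb !mulr0.
  rewrite (big_only1 m)//; last first.
    by move=> c /negPf nc _; rewrite tens12E eq_sym nc mulr0 mul0r.
  by rewrite tens12E tens13E !eqxx !mulr1.
have -> : \sum_a \sum_b \sum_c
    tens23 rq (mxtens_index (mxtens_index (i, k), m))
              (mxtens_index (mxtens_index (a, b), c)) *
    tens12 ru (mxtens_index (mxtens_index (a, b), c))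
              (mxtens_index (mxtens_index (j, l), n))
  = tensor_op ru (E l k *m tensor_op rq (E n m)) i j.
  rewrite tensor_opE (big_only1 i)//; last first.
    move=> a /negPf na _; rewrite big1// => b _; rewrite big1// => c _.
    by rewrite tens23E eq_sym na mulr0 mul0r.
  apply: eq_bigr => b _.
  rewrite (big_only1 n)//; last first.
    by move=> c /negPf nc _; rewrite tens12E nc !mulr0.
  rewrite (big_only1 l)//; last first.
    by move=> c /negPf nc _; rewrite delta_mulmxE nc mul0r mulr0.
  rewrite delta_mulmxE tensor_op_delta tens12E tens23E !eqxx.
  by rewrite !mulr1 mul1r mulrC.
have -> : \sum_a \sum_b \sum_c
    tens13 ru (mxtens_index (mxtens_index (i, k), m))
              (mxtens_index (mxtens_index (a, b), c)) *
    tens23 ru' (mxtens_index (mxtens_index (a, b), c))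
              (mxtens_index (mxtens_index (j, l), n))
  = - tensor_op ru (tensor_op rp (E l k) *m E n m) i j.
  rewrite tensor_opE (big_only1 j)//; last first.
    move=> a /negPf na _; rewrite big1// => b _; rewrite big1// => c _.
    by rewrite tens23E na !mulr0.
  rewrite (big_only1 k)//; last first.
    move=> b /negPf nb _; rewrite big1// => c _.
    by rewrite tens13E eq_sym nb mulr0 mul0r.
  rewrite [X in _ = - X](big_only1 m)//; last first.
    move=> c /negPf nc _; rewrite big1// => d _.
    by rewrite mulmx_deltaE nc !mulr0.
  rewrite -sumrN; apply: eq_bigr => c _.
  rewrite mulmx_deltaE tensor_op_delta tens13E tens23E !eqxx !mulr1.
  rewrite -mulrN; congr (_ * _).
  by rewrite -[RHS]opprK -[in RHS]tens_coef_tens21 unit tens_coefN !opprK.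
move/eqP; rewrite -addrA -opprD subr_eq0 => /eqP ->.
by rewrite /g linearD [RHS]mxE.
Qed.

(** For the functional [xi = \tr (Y *m -)], the contraction of [t] by [xi] is
the adjoint of the operator of [t] applied to Y, that is, the opposite of the
operator of [s]. *)
Lemma tensor_op_nondegenerate s t :
  tens21 s = - t -> tens_nondegenerate t -> lker (tensor_op s) == 0%VS.
Proof.
move=> st /bij_inj inj; apply/lker0P => Y Z YZ.
pose xi Y : 'Hom(A, K^o) := linfun (fun X => \tr (Y *m X) : K^o).
have xiE Y' i j : xi Y' (E i j) = Y' j i.
  have lin : linear (fun X => \tr (Y' *m X) : K^o).
    by move=> c U V; rewrite mulmxDr -scalemxAr linearP.
  pose F : {linear A -> K^o} := HB.pack (fun X => \tr (Y' *m X) : K^o)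
    (GRing.isLinear.Build _ _ _ _ _ lin).
  rewrite -[xi Y']/(linfun F) lfunE /= /mxtrace (big_only1 j)//; last first.
    by move=> a /negPf na _; rewrite mulmx_deltaE na mulr0.
  by rewrite mulmx_deltaE eqxx mulr1.
have contractE Y' :
    tens_lift (fun X Z' => xi Y' X *: Z') t = - tensor_op s Y'.
  apply/matrixP => x y; rewrite tens_liftE [RHS]mxE tensor_opE -sumrN.
  apply: eq_bigr => i _; rewrite -sumrN; apply: eq_bigr => j _.
  rewrite (big_only1 x)//; last first.
    move=> c /negPf nc _; rewrite big1// => d _.
    by rewrite !mxE [x == c]eq_sym nc !mulr0.
  rewrite (big_only1 y)//; last first.
    by move=> d /negPf nd _; rewrite !mxE [y == d]eq_sym nd andbF !mulr0.
  rewrite !mxE !eqxx mulr1 xiE -mulNr; congr (_ * _).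
  by rewrite -(tens_coef_tens21 s) st tens_coefN opprK.
have xiYZ : xi Y = xi Z by apply: inj; rewrite /= !contractE YZ.
by apply/matrixP => i j; rewrite -!xiE xiYZ.
Qed.

End TensorOperator.

(** * The operator identity *)

Section RotaBaxter.
Set Implicit Arguments.
Unset Strict Implicit.
Unset Printing Implicit Defensive.
Variables (K : numFieldType) (N : nat).
Hypothesis N_gt0 : (0 < N)%N.
Local Notation A := 'M[K]_N.
Local Notation E i j := (delta_mx i j : A).
Implicit Types (X Y Z : A).
Let i0 : 'I_N := Ordinal N_gt0.

(** Commuting with the single column of matrix units [E j i0] is enough. *)
Lemma central_scalar Y : (forall X, Y *m X = X *m Y) -> Y = (Y i0 i0)%:M.
Proof.
move=> Yc; apply/matrixP => i j.
have := congr1 (fun M : A => M i i0) (Yc (E j i0)).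
by rewrite mulmx_deltaE delta_mulmxE eqxx mulr1 => ->; rewrite mxE mulr_natl.
Qed.

(** The inner element is the sum over k of D(e_(k0)) e_(0k): expanding both
products in matrix units gives b X = sum_k D(X e_(k0)) e_(0k), and by the
Leibniz rule this is D(X) + X b.  Subtracting a scalar matrix removes the
trace without changing the commutator. *)
Lemma derivation_inner (D : 'End(A)) :
  (forall Y Z, D (Y *m Z) = D Y *m Z + Y *m D Z) ->
  exists2 a : A, \tr a = 0 & forall X, D X = a *m X - X *m a.
Proof.
move=> Dder.
pose b := \sum_k D (E k i0) *m E i0 k.
have bX X : D X = b *m X - X *m b.
  have swap : b *m X = \sum_k D (X *m E k i0) *m E i0 k.
    rewrite mulmx_suml.
    have -> : \sum_k D (X *m E k i0) *m E i0 k =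
        \sum_k \sum_l X l k *: (D (E l i0) *m E i0 k).
      apply: eq_bigr => k _.
      have -> : X *m E k i0 = \sum_l X l k *: E l i0.
        apply/matrixP => i j; rewrite mulmx_deltaE summxE (big_only1 i)//.
          by rewrite !mxE eqxx.
        by move=> l /negPf nl _; rewrite !mxE eq_sym nl mulr0.
      rewrite linear_sum mulmx_suml; apply: eq_bigr => l _.
      by rewrite linearZ scalemxAl.
    rewrite exchange_big; apply: eq_bigr => l _ /=.
    rewrite -mulmxA.
    have -> : E i0 l *m X = \sum_k X l k *: E i0 k.
      apply/matrixP => i j; rewrite delta_mulmxE summxE (big_only1 j)//.
        by rewrite !mxE eqxx andbT mulrC.
      by move=> k /negPf nk _; rewrite !mxE [j == _]eq_sym nk andbF mulr0.
    by rewrite mulmx_sumr; apply: eq_bigr => k _; rewrite -scalemxAr.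
  have one : \sum_k E k k = 1%:M.
    by rewrite [RHS]scalar_mx_sum_delta; apply: eq_bigr => k _; rewrite scale1r.
  rewrite swap; under eq_bigr => k _.
    rewrite Dder mulmxDl -!mulmxA mul_delta_mx.
    over.
  rewrite big_split -!mulmx_sumr /= one mulmx1 addrK //.
exists (b - (\tr b / N%:R)%:M) => [|X].
  rewrite linearB /= mxtrace_scalar -[X in _ - X]mulr_natr divfK ?subrr//.
  by rewrite pnatr_eq0 -lt0n.
rewrite bX mulmxBl mulmxBr mul_scalar_mx mul_mx_scalar.
by rewrite opprB addrA subrK.
Qed.

Variables (phi : K -> 'End(A)) (e : K).
Local Notation small p := (p != 0 /\ `|p| < e).
(* Invertibility is required up to radius 2e so that it covers phi_(p+q). *)
Hypothesis phi_inj : forall p, p != 0 -> `|p| < e + e -> lker (phi p) == 0%VS.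
Hypothesis phi_RB : forall p q, small p -> small q -> p + q != 0 ->
  forall Y Z, phi p Y *m phi q Z = phi (p + q) (Y *m phi q Z + phi p Y *m Z).

Let psi p : 'End(A) := (phi p)^-1%VF.

Lemma psi_mul p q : small p -> small q -> p + q != 0 ->
  forall Y Z, psi (p + q) (Y *m Z) = psi p Y *m Z + Y *m psi q Z.
Proof.
move=> sp sq pq Y Z.
have lt2 (u : K) : `|u| < e -> `|u| < e + e.
  by move=> ue; rewrite (lt_le_trans ue)// lerDl (le_trans _ (ltW ue)).
have phiK u : small u -> forall X, phi u (psi u X) = X.
  case=> u0 ue X; have inj := phi_inj u0 (lt2 u ue).
  have := lker0_compfV inj => /(congr1 (fun f : 'End(A) => f X)).
  by rewrite comp_lfunE id_lfunE.
have := phi_RB sp sq pq (psi p Y) (psi q Z).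
rewrite !phiK// => ->; rewrite lker0_lfunK//.
apply: phi_inj => //; apply: le_lt_trans (ler_normD _ _) _.
by apply: ltrD; [case: sp | case: sq].
Qed.

(** The identity says nothing about pairs with p + q = 0.  Two parameters that
are opposite to each other are therefore compared through their halves. *)
Lemma rota_baxter_classification : 0 < e ->
  exists (beta : K -> K) (a : A), [/\ \tr a = 0,
    forall p q, small p -> small q -> p + q != 0 ->
      beta (p + q) = beta p + beta q &
    forall p, small p -> forall X,
      (phi p)^-1%VF X = beta p *: X + (a *m X - X *m a)].
Proof.
move=> e0.
pose beta p := psi p 1%:M i0 i0.
have add2_neq0 (p : K) : p != 0 -> p + p != 0.
  by move=> p0; rewrite -mulr2n mulrn_eq0.
have psiDr p q X : small p -> small q -> p + q != 0 ->
    psi (p + q) X = psi p X + X *m psi q 1%:M.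
  by move=> sp sq pq; have := psi_mul sp sq pq X 1%:M; rewrite !mulmx1.
have psiDl p q X : small p -> small q -> p + q != 0 ->
    psi (p + q) X = psi p 1%:M *m X + psi q X.
  by move=> sp sq pq; have := psi_mul sp sq pq 1%:M X; rewrite !mul1mx.
have psi1 p : small p -> psi p 1%:M = (beta p)%:M.
  move=> sp; apply: central_scalar => X; apply/(@addIr _ (psi p X)).
  have pp : p + p != 0 by apply: add2_neq0; case: sp.
  by rewrite -psiDl// psiDr// addrC.
have betaD p q : small p -> small q -> p + q != 0 ->
    beta (p + q) = beta p + beta q.
  move=> sp sq pq; rewrite {1}/beta psiDr// mul1mx !psi1//.
  by rewrite !mxE eqxx.
pose D p : 'End(A) := psi p - beta p *: \1%VF.
have DE p X : D p X = psi p X - beta p *: X.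
  by rewrite /D !lfun_simp.
have Deq p q : small p -> small q -> p + q != 0 -> D p = D q.
  move=> sp sq pq; apply/lfunP => X; rewrite !DE.
  apply/eqP; rewrite subr_eq addrAC eq_sym subr_eq; apply/eqP.
  have := psiDr p q X sp sq pq; rewrite (psiDl _ _ _ sp sq pq) !psi1//.
  by rewrite mul_scalar_mx mul_mx_scalar addrC.
have small_half p : small p -> small (p / 2).
  case=> p0 pe; rewrite mulf_neq0 ?invr_eq0 ?pnatr_eq0//; split=> //.
  rewrite normrM normfV (ger0_norm (ler0n _ _)) ltr_pdivrMr//.
  by rewrite mulr_natr mulr2n (lt_le_trans pe)// lerDl ltW.
(* The Leibniz rule for D is read off at the parameters p0, p0 and
   p0 + p0 = q0, which must all be small. *)
pose q0 := e / 2; pose p0 := q0 / 2.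
have se2 : small q0.
  rewrite /q0; split; first by rewrite mulf_neq0 ?invr_eq0 ?pnatr_eq0// gt_eqF.
  by rewrite gtr0_norm ?divr_gt0// ltr_pdivrMr// mulr_natr mulr2n ltrDl.
have sp0 : small p0 by apply: small_half.
have p00 : p0 + p0 = q0 by rewrite /p0 -splitr.
have D2 p : small p -> D p = D (p / 2).
  move=> sp; apply: Deq => //; first exact: small_half.
  rewrite -[X in X / 2]/(p) {1}(splitr p) -[_ + _ + _]addrA.
  rewrite -!mulr2n -mulrS mulrn_eq0 /=.
  by have [] := small_half p sp.
have Dconst p : small p -> D p = D p0.
  move=> sp; have [pp0|pp0] := eqVneq (p + p0) 0; last exact: Deq.
  rewrite D2//; apply: Deq => //; first exact: small_half.
  have -> : p = - p0 by apply/eqP; rewrite -addr_eq0 pp0.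
  rewrite mulNr addrC {1}(splitr p0) addrK.
  by have [] := small_half p0 sp0.
have Dder Y Z : D p0 (Y *m Z) = D p0 Y *m Z + Y *m D p0 Z.
  rewrite -{1}(Dconst q0)// DE -p00 psi_mul ?p00//; last by case: se2.
  rewrite -p00 betaD ?p00//; last by case: se2.
  rewrite !DE mulmxBl mulmxBr -scalemxAl -scalemxAr scalerDl opprD.
  by rewrite addrACA.
have [a tra aE] := derivation_inner Dder.
exists beta, a; split=> // p sp X.
by rewrite -aE -(Dconst p)// DE addrC subrK.
Qed.

End RotaBaxter.

(** * Complex analysis near 0 *)

Section Analysis.
Set Implicit Arguments.
Unset Strict Implicit.
Unset Printing Implicit Defensive.
Variable R : realType.
Local Notation C := R[i].
Local Notation Ctop := R[i]^o.

Lemma near0_ball (P : Ctop -> Prop) : (\forall x \near (0 : Ctop), P x) ->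
  exists2 e : C, 0 < e & forall x : C, `|x| < e -> P x.
Proof. by move=> /nbhs_norm0P[e /= e0 H]; exists e => // x xe; apply: H. Qed.

Lemma ball_near0 (P : Ctop -> Prop) (e : C) : 0 < e ->
  (forall x : C, `|x| < e -> P x) -> \forall x \near (0 : Ctop), P x.
Proof. by move=> e0 H; apply/nbhs_norm0P; exists e => // x xe; apply: H. Qed.

(** The norm of [R[i]] takes values in [R[i]] itself; the Archimedean property is
borrowed from the real parts. *)
Lemma halving_small (x d : C) : 0 < d -> exists n, `|x / 2 ^+ n| < d.
Proof.
move=> d0; pose y := complex.Re `|x| / complex.Re d.
have dE : d = (complex.Re d)%:C.
  by move: (d) d0; case=> a b; rewrite ltcE /= => /andP[/eqP-> _].
have d0' : 0 < complex.Re d by move: d0; rewrite ltcE => /andP[].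
have xE : `|x| = (complex.Re `|x|)%:C by [].
exists (Num.bound y).
rewrite normrM normfV normrX (ger0_norm (ler0n _ _)) ltr_pdivrMr ?exprn_gt0//.
rewrite xE dE -natrX mulrC mulr_natl -rmorphMn ltcR -mulr_natl -ltr_pdivrMr//.
have x0 : 0 <= complex.Re `|x|.
  by have := normr_ge0 x; rewrite xE lecE => /andP[].
have y0 : 0 <= y by rewrite divr_ge0// ltW.
apply: lt_le_trans (archi_boundP y0) _.
by rewrite ler_nat ltnW// ltn_expl.
Qed.

(** By additivity the difference quotient of beta at z0 is beta(h)/h, which thus
tends to some c as h tends to 0.  Additivity also makes beta(p)/p invariant
under halving p, so this ratio is already equal to its limit c. *)
Lemma local_additive_linear (beta : Ctop -> Ctop) (e z0 : C) : 0 < e ->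
  (forall p q : C, p != 0 /\ `|p| < e -> q != 0 /\ `|q| < e -> p + q != 0 ->
     beta (p + q) = beta p + beta q) ->
  z0 != 0 -> `|z0| < e -> derivable beta z0 1 ->
  exists c : C, forall p : C, p != 0 -> `|p| < e -> beta p = c * p.
Proof.
move=> e0 betaD z00 z0e dbeta.
pose c := lim (h^-1 *: ((beta \o shift z0) (h *: 1) - beta z0) @[h --> (0:Ctop)^']).
have half_small (p : C) : p != 0 /\ `|p| < e -> p / 2 != 0 /\ `|p / 2| < e.
  case=> p0 pe; rewrite mulf_neq0 ?invr_eq0 ?pnatr_eq0//; split=> //.
  rewrite normrM normfV (ger0_norm (ler0n _ _)) ltr_pdivrMr//.
  by rewrite mulr_natr mulr2n (lt_le_trans pe)// lerDl ltW.
have halving (p : C) n : p != 0 /\ `|p| < e ->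
    [/\ p / 2 ^+ n != 0, `|p / 2 ^+ n| < e & beta (p / 2 ^+ n) = beta p / 2 ^+ n].
  move=> sp; elim: n => [|n [n0 ne IH]]; first by rewrite !divr1; case: sp.
  have [h0 he] := half_small _ (conj n0 ne).
  rewrite exprSr invfM mulrA; split=> //.
  have := betaD _ _ (conj h0 he) (conj h0 he).
  rewrite -splitr IH => /(_ n0) bE.
  by rewrite mulrA bE -mulr2n -(mulr_natr (beta _)) mulfK ?pnatr_eq0.
exists c => p p0 pe; apply/eqP; rewrite -[_ == _]negbK; apply/negP => cp.
pose eps := `|c - beta p / p|.
have eps0 : 0 < eps.
  rewrite normr_gt0 subr_eq0; apply: contra cp => /eqP->.
  by rewrite divfK.
have /cvgrPdist_lt /(_ eps eps0) near_eps := dbeta : cvg _.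
have near_z0 : \forall h \near (0 : Ctop), `|h| < `|z0|.
  by apply: (@ball_near0 _ `|z0|) => //; rewrite normr_gt0.
have [d d0 Hd] := near0_ball (@filterI _ (nbhs (0 : Ctop)) _
  (fun h => h != 0 -> `|c - h^-1 *: (beta (h *: 1 + z0) - beta z0)| < eps) _
  near_eps near_z0).
have [n nd] := halving_small p d0.
have [h0 he hE] := halving p n (conj p0 pe).
have [/(_ h0) close hz0] := Hd _ nd.
(* Additivity is only available for z0 + h <> 0, hence the bound |h| < |z0|. *)
have hz1 : p / 2 ^+ n + z0 != 0.
  by rewrite addr_eq0; apply: contraTneq hz0 => ->; rewrite normrN ltxx.
move: close; set h := p / 2 ^+ n.
rewrite -[h *: 1]/(h * 1) mulr1 betaD// addrK hE -[_ *: _]/(h^-1 * _).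
have -> : h^-1 * (beta p / 2 ^+ n) = beta p / p.
  rewrite /h invf_div mulrAC [beta p * _]mulrC mulrA divff ?mul1r 1?mulrC//.
by rewrite ltxx.
Qed.

Lemma near_punctured_ball (e z : C) : z != 0 -> `|z| < e ->
  \forall x \near (z : Ctop), x != 0 /\ `|x| < e.
Proof.
move=> z0 ze; apply: filterS2 (_ : \forall x \near (z : Ctop), `|z - x| < `|z|)
  (_ : \forall x \near (z : Ctop), `|z - x| < e - `|z|).
- move=> x xz xe; split.
    by apply: contraTneq xz => ->; rewrite subr0 ltxx.
  rewrite -[x](subKr z) (le_lt_trans (ler_normB _ _))//.
  by rewrite -ltrBrDl.
- by apply/nbhs_normP; exists `|z| => //=; rewrite normr_gt0.
- by apply/nbhs_normP; exists (e - `|z|) => //=; rewrite subr_gt0.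
Qed.

(** Away from 0 the function is g(z) / z^n with g holomorphic near 0. *)
Lemma meromorphic_derivable (f : Ctop -> Ctop) : meromorphic_at f 0 ->
  \forall z \near (0 : Ctop)^', derivable f z 1.
Proof.
move=> [n [g [ghol /near0_ball[e e0 fg]]]].
have [d d0 dg] := near0_ball ghol.
apply: filterS2 (_ : \forall z \near (0 : Ctop), `|z| < d)
  (_ : \forall z \near (0 : Ctop), `|z| < e); last 2 first.
- exact: (@ball_near0 _ d).
- exact: (@ball_near0 _ e).
move=> z zd ze z0.
apply: (@near_eq_derivable _ _ _ (g * (fun x : Ctop => (x ^+ n)^-1))).
  apply: filterS (near_punctured_ball z0 ze) => x [x0 xe].
  rewrite -[LHS]/(g x * (x ^+ n)^-1) -(fg x xe x0) subr0 mulrC mulKf//.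
  by rewrite expf_neq0.
apply: derivableM; first exact: dg.
apply: derivableV; first by rewrite expf_neq0.
exact: exprn_derivable.
Qed.

(** These diagonal entries are the partial traces whose inverse is the scalar
function beta, so their regularity is what makes beta differentiable. *)
Lemma near_trace_derivable (N : nat) (r : Ctop -> 'M[C]_(N * N)) (i : 'I_N) :
  mx_meromorphic_near0 r ->
  \forall z \near (0 : Ctop)^',
    derivable (fun u => tensor_op (r u) 1%:M i i : Ctop) z 1.
Proof.
move=> mero.
have : \forall z \near (0 : Ctop)^', forall k : 'I_N,
    derivable (fun u => tens_coef (r u) i i k k : Ctop) z 1.
  apply: filter_forall => k; apply: meromorphic_derivable.
  by have := mero (mxtens_index (i, k)) (mxtens_index (i, k)) => /nbhs_singleton.
apply: filterS => z dz.
have -> : (fun u => tensor_op (r u) 1%:M i i : Ctop) =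
    \sum_k (fun u => tens_coef (r u) i i k k : Ctop).
  apply/funext => u; rewrite fct_sumE tensor_opE; apply: eq_bigr => k _.
  rewrite (big_only1 k)//; first by rewrite mxE eqxx mulr1.
  by move=> l /negPf nl _; rewrite mxE nl mulr0.
exact: derivable_sum.
Qed.

End Analysis.

(** * Classification of the solutions *)

Theorem proposition1p1 (R : realType) (N : nat) (hN : (0 < N)%N)
    (r : R[i]^o -> 'M[R[i]]_(N * N))
    (r_mero : mx_meromorphic_near0 r)
    (r_nondeg : generically_nondegenerate r)
    (r_unitary : unitary r)
    (r_AYBE : AYBE r) :
  exists (c : R[i]) (a : 'M[R[i]]_N), c != 0 /\ \tr a = 0 /\
    \forall u \near (0 : R[i]^o)^',
      exists phi : 'End('M[R[i]]_N),
        is_phi a (c * u) phi /\ r u = tens_map1 phi (tensP R[i] N).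
Proof.
pose i0 := Ordinal hN.
pose phi u := tensor_op (r u).
have [[Q1 Q2] /= [Q1n Q2n] aybe] := r_AYBE.
have [e1 e1_gt0 Q1e] := near0_ball Q1n.
have [e2 e2_gt0 Q2e] := near0_ball Q2n.
have [e3 e3_gt0 nondeg] := near0_ball r_nondeg.
have [e4 e4_gt0 unit] := near0_ball r_unitary.
have [e5 e5_gt0 trd] := near0_ball (near_trace_derivable i0 r_mero).
have : \forall u \near (0 : R[i]^o),
    [/\ `|u| < e1, `|u| < e2, `|u| < e3, `|u| < e4 & `|u| < e5].
  near=> u; split; near: u; [exact: (@ball_near0 _ _ e1)|
    exact: (@ball_near0 _ _ e2)|exact: (@ball_near0 _ _ e3)|
    exact: (@ball_near0 _ _ e4)|exact: (@ball_near0 _ _ e5)].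
move=> /near0_ball[d d0 small].
pose e := d / 2.
have e0 : 0 < e by rewrite divr_gt0.
have eed : e + e = d by rewrite -splitr.
have ltd (u : R[i]) : `|u| < e -> `|u| < d.
  by move=> ue; rewrite (lt_trans ue)// -eed ltrDl.
have unitN (p : R[i]) : p != 0 -> `|p| < d -> tens21 (r p) = - r (- p).
  move=> p0 pd; rewrite -[X in tens21 (r X)]opprK.
  by apply: unit; rewrite ?oppr_eq0 ?normrN//; case: (small _ pd).
have inj (p : R[i]) : p != 0 -> `|p| < e + e -> lker (phi p) == 0%VS.
  rewrite eed => p0 pd; apply: tensor_op_nondegenerate (unitN _ p0 pd) _.
  by apply: nondeg; rewrite ?oppr_eq0 ?normrN//; case: (small _ pd).
have RB (p q : R[i]) : p != 0 /\ `|p| < e -> q != 0 /\ `|q| < e ->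
    p + q != 0 -> forall Y Z,
    phi p Y *m phi q Z = phi (p + q) (Y *m phi q Z + phi p Y *m Z).
  move=> [p0 pe] [q0 qe] pq.
  apply: (AYBE_op (unitN _ p0 (ltd _ pe))).
  have pqd : `|p + q| < d.
    by rewrite (le_lt_trans (ler_normD _ _))// -eed ltrD.
  (* the substitution u = p + q, u' = -p, so that u + u' = q *)
  have := aybe (p + q, - p); rewrite /= opprK addrAC subrr add0r; apply => //.
    split => /=.
      by apply: Q1e; case: (small _ pqd).
    by apply: Q2e; rewrite normrN; case: (small _ (ltd _ pe)).
  by rewrite oppr_eq0.
have [beta [a [tra betaD psiE]]] := rota_baxter_classification hN inj RB e0.
pose tr0 u : R[i] := phi u 1%:M i0 i0.
have betaM (p : R[i]) : p != 0 -> `|p| < e -> beta p * tr0 p = 1.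
  move=> p0 pe.
  have pinj : lker (phi p) == 0%VS by apply: inj; rewrite // eed ltd.
  have := lker0_compfV pinj => /(congr1 (fun f : 'End('M[R[i]]_N) => f 1%:M i0 i0)).
  rewrite comp_lfunE id_lfunE psiE// mulmx1 mul1mx subrr addr0 linearZ /=.
  by rewrite !mxE eqxx.
have [z0 z00 z0e] : exists2 z0 : R[i], z0 != 0 & `|z0| < e.
  exists (e / 2); first by rewrite gt_eqF// divr_gt0.
  by rewrite gtr0_norm ?divr_gt0// ltr_pdivrMr// mulr_natr mulr2n ltrDl.
have beta_derivable : derivable (beta : R[i]^o -> R[i]^o) z0 1.
  apply: (@near_eq_derivable _ R[i]^o R[i]^o (fun u => (tr0 u)^-1) beta z0 1).
    apply: filterS (near_punctured_ball z00 z0e) => p [p0 pe].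
    have trp0 : tr0 p != 0.
      by apply: contra_eq_neq (betaM p p0 pe) => ->; rewrite mulr0 eq_sym oner_eq0.
    by rewrite -[LHS]mul1r -(betaM p)// mulfK.
  apply: derivableV.
    by apply: contra_eq_neq (betaM z0 z00 z0e) => ->; rewrite mulr0 eq_sym oner_eq0.
  by apply: trd => //; case: (small _ (ltd _ z0e)).
have [c betac] := local_additive_linear e0 betaD z00 z0e beta_derivable.
exists c, a; split; [|split=> //].
  apply: contra_eq_neq (betaM z0 z00 z0e) => c0.
  by rewrite betac// c0 !mul0r eq_sym oner_eq0.
apply: (ball_near0 e0) => u ue u0; exists (phi u).
split; last by rewrite tens_map1_tensP.
move=> X; rewrite -betac// -psiE// lker0_lfunK//.
by apply: inj; rewrite // eed ltd.
Unshelve. all: by end_near. Qed.
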